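(* Let $X$ be a completely regular space, $\beta X$ its Stone–Čech compactification, $G$ an abelian group and $n\ge-1$ an integer. Then $\eta_G(\beta X)=n$ if and only if $\eta_G^F(X)=n$.
   Context: Completely regular spaces are Tychonoff spaces. A subset $U\subset X$ is functionally open if $U=f^{-1}((0,1])$ for some continuous $f:X\to[0,1]$. Let $cov_F(X)$ be the set of finite indexed covers $\alpha=\{\alpha_v\}_{v\in V_\alpha}$ of $X$ by functionally open sets, directed by refinement: $\alpha\le\alpha'$ iff every member of $\alpha'$ is contained in a member of $\alpha$. The nerve $X_\alpha$ is the simplicial complex of nonempty finite $s\subset V_\alpha$ with $\bigcap_{v\in s}\alpha_v\neq\emptyset$. For $\alpha\le\alpha'$ any refinement projection $p_{\alpha\alpha'}:V_{\alpha'}\to V_\alpha$ (with $\alpha'_{v}\subset\alpha_{p_{\alpha\alpha'}(v)}$) is a simplicial map $X_{\alpha'}\to X_\alpha$, and the induced homomorphism $p^*_{\alpha\alpha'}:H^n(X_\alpha;G)\to H^n(X_{\alpha'};G)$ of simplicial cohomology does not depend on its choice. The functional cohomology group is $\hat H^n_F(X;G)=\varinjlim\{H^n(X_\alpha;G),p^*_{\alpha\alpha'},cov_F(X)\}$. The functional coefficient of cyclicity $\eta_G^F(X)\in\mathbb{N}\cup\{0,-1,\infty\}$ is defined as follows: $\eta_G^F(\emptyset)=-1$; $\eta_G^F(X)=n$ if $\hat H_F^m(X;G)=0$ for all $m>n$ and $\hat H_F^n(X;G)\neq0$; and $\eta_G^F(X)=\infty$ if $X\neq\emptyset$ and for every $m$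 there is $n\ge m$ with $\hat H_F^n(X;G)\ne0$. The (Bokstein–Nowak) coefficient of cyclicity $\eta_G(Y)$ of a compact Hausdorff space $Y$ is defined in the same way using the usual Čech cohomology groups $\hat H^n(Y;G)$ (direct limit over all open covers of $Y$) in place of $\hat H^n_F$. *)

(* Defs.v *)
From HB Require Import structures.
From mathcomp Require Import all_boot all_order perm all_algebra.
From mathcomp Require Import all_classical all_reals all_analysis.

Set Implicit Arguments.
Unset Strict Implicit.
Unset Printing Implicit Defensive.

Import Order.TTheory GRing.Theory Num.Theory.
Import numFieldNormedType.Exports.

Local Open Scope classical_set_scope.
Local Open Scope ring_scope.
Local Open Scope quotient_scope.

(** * Simplicial complexes *)

(* Not every element of V has to be a vertex: in the nerve of an indexed cover
   the index of an empty member spans no simplex. *)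
Record simplicial_complex (V : Type) := SimplicialComplex {
  face : set (set V);
  face_nonempty : forall s, face s -> s !=set0;
  face_finite : forall s, face s -> finite_set s;
  face_sub : forall s t, face s -> t !=set0 -> t `<=` s -> face t }.

Record simplicial_map (V W : Type)
    (K : simplicial_complex V) (L : simplicial_complex W) := SimplicialMap {
  vertex_map :> V -> W;
  face_image : forall s, face K s -> face L (vertex_map @` s) }.

(* Ordered n-simplices, repetitions of vertices allowed. *)
Record osimplex (V : Type) (K : simplicial_complex V) (n : nat) := OSimplex {
  vertex :> 'I_n.+1 -> V;
  osimplex_face : face K (range vertex) }.

Section OrderedSimplices.
Context {V : Type} {K : simplicial_complex V}.

Lemma osimplex_eq n (s t : osimplex K n) : s =1 t -> s = t.
Proof.
case: s t => [s hs] [t ht] /= /funext est; subst t.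
by rewrite (Prop_irrelevance hs ht).
Qed.

Fact osimplex_reindex_face m n (s : osimplex K n) (f : 'I_m.+1 -> 'I_n.+1) :
  face K (range (fun i => s (f i))).
Proof.
apply: face_sub (osimplex_face s) _ _; first by exists (s (f ord0)), ord0.
by move=> _ [i _ <-]; exists (f i).
Qed.

Definition osimplex_reindex m n (s : osimplex K n) (f : 'I_m.+1 -> 'I_n.+1) :
  osimplex K m := OSimplex (osimplex_reindex_face s f).

End OrderedSimplices.

Section OSimplexMap.
Context {V W : Type} {K : simplicial_complex V} {L : simplicial_complex W}.
Variable f : simplicial_map K L.

Fact osimplex_map_face n (s : osimplex K n) : face L (range (fun i => f (s i))).
Proof.
have := face_image f (osimplex_face s); rewrite image_comp.
by congr (face L _).
Qed.

Definition osimplex_map n (s : osimplex K n) : osimplex L n :=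
  OSimplex (osimplex_map_face s).

End OSimplexMap.

(** * Simplicial cohomology *)

Section Cohomology.
Context {V : Type} (K : simplicial_complex V) (n : nat) (G : zmodType).

(* The n-cochains of K, i.e., the homomorphisms from the group of oriented
   n-chains to G: this group is generated by the ordered n-simplices, subject
   to the two kinds of relations below. *)
Definition alternating_cochain (c : osimplex K n -> G) : Prop :=
  (forall (s : osimplex K n) (p : 'S_n.+1),
     c (osimplex_reindex s p) = c s *~ (-1) ^+ odd_perm p) /\
  (forall s : osimplex K n, ~ injective s -> c s = 0).

Definition coboundary (c : osimplex K n -> G) (s : osimplex K n.+1) : G :=
  \sum_(i < n.+2) c (osimplex_reindex s (lift i)) *~ (-1) ^+ i.

Lemma coboundaryB (b c : osimplex K n -> G) :
  coboundary (b - c) = coboundary b - coboundary c.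
Proof.
apply/funext => s.
rewrite -[RHS]/(coboundary b s - coboundary c s) /coboundary -sumrB.
by apply: eq_bigr => i _; rewrite mulrzBl.
Qed.

Lemma coboundary0 : coboundary 0 = 0.
Proof. by rewrite -(subrr 0) coboundaryB subrr. Qed.

Lemma alternating_cochainB (b c : osimplex K n -> G) :
  alternating_cochain b -> alternating_cochain c -> alternating_cochain (b - c).
Proof.
move=> [b1 b2] [c1 c2]; split => [s p|s si].
  by rewrite -[LHS]/(b _ - c _) b1 c1 -mulrzBl.
by rewrite -[LHS]/(b _ - c _) b2// c2// subr0.
Qed.

Lemma alternating_cochain0 : alternating_cochain 0.
Proof. by split => // s p; rewrite -[LHS]/(0 : G) mul0rz. Qed.

Definition cocycle_pred : {pred (osimplex K n -> G)} :=
  [pred c | `[< alternating_cochain c /\ coboundary c = 0 >]].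

Fact cocycle_zmod_closed : zmod_closed cocycle_pred.
Proof.
split => [|b c]; rewrite !inE.
  by split; [exact: alternating_cochain0|exact: coboundary0].
move=> [ab db] [ac dc].
by split; [exact: alternating_cochainB|rewrite coboundaryB db dc subr0].
Qed.
HB.instance Definition _ :=
  GRing.isZmodClosed.Build _ cocycle_pred cocycle_zmod_closed.

Record cocycle := Cocycle {
  cocycle_val :> osimplex K n -> G;
  cocycleP : cocycle_val \in cocycle_pred }.
HB.instance Definition _ := [isSub for cocycle_val].
HB.instance Definition _ := [Choice of cocycle by <:].
HB.instance Definition _ := [SubChoice_isSubZmodule of cocycle by <:].

End Cohomology.

Definition is_coboundary {V : Type} (K : simplicial_complex V) (n : nat)
    (G : zmodType) : (osimplex K n -> G) -> Prop :=
  match n return (osimplex K n -> G) -> Prop with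
  | 0 => fun c => c = 0
  | m.+1 => fun c =>
      exists2 b : osimplex K m -> G, alternating_cochain b & coboundary b = c
  end.

Lemma is_coboundary0 {V : Type} (K : simplicial_complex V) n (G : zmodType) :
  is_coboundary (0 : osimplex K n -> G).
Proof.
case: n => [//|m]; exists 0; first exact: alternating_cochain0.
exact: coboundary0.
Qed.

Lemma is_coboundaryB {V : Type} (K : simplicial_complex V) n (G : zmodType)
    (b c : osimplex K n -> G) :
  is_coboundary b -> is_coboundary c -> is_coboundary (b - c).
Proof.
case: n b c => [_ _ -> -> /=|m _ _ [b hb <-] [c hc <-]]; first by rewrite subr0.
by exists (b - c); [exact: alternating_cochainB|rewrite coboundaryB].
Qed.

Section CohomologyGroup.
Context {V : Type} (K : simplicial_complex V) (n : nat) (G : zmodType).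

Definition coboundary_pred : {pred (cocycle K n G)} :=
  [pred c : cocycle K n G | `[< is_coboundary c >]].

Fact coboundary_zmod_closed : zmod_closed coboundary_pred.
Proof.
split => [|b c]; rewrite !inE; first exact: is_coboundary0.
exact: is_coboundaryB.
Qed.
HB.instance Definition _ :=
  GRing.isZmodClosed.Build _ coboundary_pred coboundary_zmod_closed.

Definition cohomology : zmodType := {ideal_quot coboundary_pred}.

Definition cohomology_class (c : cocycle K n G) : cohomology :=
  \pi_({ideal_quot coboundary_pred}) c.

End CohomologyGroup.

Section InducedMap.
Context {V W : Type} {K : simplicial_complex V} {L : simplicial_complex W}.
Variables (f : simplicial_map K L) (n : nat) (G : zmodType).

Definition pullback m (c : osimplex L m -> G) (s : osimplex K m) : G :=
  c (osimplex_map f s).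

Lemma pullback_alternating m (c : osimplex L m -> G) :
  alternating_cochain c -> alternating_cochain (pullback c).
Proof.
move=> [c1 c2]; split => [s p|s si].
  by rewrite /pullback -c1; congr c; exact: osimplex_eq.
rewrite /pullback; apply: c2 => fsi; apply: si => i j sij.
by apply: fsi => /=; rewrite sij.
Qed.

Lemma coboundary_pullback m (c : osimplex L m -> G) :
  coboundary (pullback c) = pullback (coboundary c).
Proof.
apply/funext => s; apply: eq_bigr => i _; congr (_ *~ _).
by rewrite /pullback; congr c; exact: osimplex_eq.
Qed.

Lemma is_coboundary_pullback m (c : osimplex L m -> G) :
  is_coboundary c -> is_coboundary (pullback c).
Proof.
case: m c => [_ ->//|m _ [b ab <-]].
exists (pullback b); first exact: pullback_alternating.
exact: coboundary_pullback.
Qed.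

Fact pullback_cocycle_subproof (c : cocycle L n G) :
  pullback c \in @cocycle_pred _ K n G.
Proof.
rewrite inE.
have := cocycleP c; rewrite inE => -[ac dc].
split; first exact: pullback_alternating.
by rewrite coboundary_pullback dc.
Qed.

Definition pullback_cocycle (c : cocycle L n G) : cocycle K n G :=
  Cocycle (pullback_cocycle_subproof c).

Definition cohomology_map (x : cohomology L n G) : cohomology K n G :=
  cohomology_class (pullback_cocycle (repr x)).

Lemma cohomology_mapE (c : cocycle L n G) :
  cohomology_map (cohomology_class c) = cohomology_class (pullback_cocycle c).
Proof.
rewrite /cohomology_map /cohomology_class.
set r := repr _; apply/eqP; rewrite -Quotient.idealrBE inE.
have : r - c \in @coboundary_pred _ L n G.
  by rewrite Quotient.idealrBE /r reprK.
rewrite inE.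
exact: is_coboundary_pullback.
Qed.

End InducedMap.

(** * Direct limits of abelian groups *)

(* The quotient of the direct sum of the A i by the subgroup generated by the
   elements [inj x - inj (phi x)], for all transition maps phi : A i -> A j. *)
Section DirectLimit.
Context {I : Type} (A : I -> zmodType).
Variable transition : forall i j, set (A i -> A j).

Definition dep_prod : Type := forall i, A i.
HB.instance Definition _ := Choice.copy dep_prod (forall i, A i).

Let dep_prod0 : dep_prod := fun=> 0.
Let dep_prodN (x : dep_prod) : dep_prod := fun i => - x i.
Let dep_prodD (x y : dep_prod) : dep_prod := fun i => x i + y i.

Fact dep_prodA : associative dep_prodD.
Proof.
by move=> x y z; apply: functional_extensionality_dep => i; exact: addrA.
Qed.
Fact dep_prodC : commutative dep_prodD.
Proof.
by move=> x y; apply: functional_extensionality_dep => i; exact: addrC.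
Qed.
Fact dep_prod0D : left_id dep_prod0 dep_prodD.
Proof. by move=> x; apply: functional_extensionality_dep => i; exact: add0r. Qed.
Fact dep_prodND : left_inverse dep_prod0 dep_prodN dep_prodD.
Proof. by move=> x; apply: functional_extensionality_dep => i; exact: addNr. Qed.
HB.instance Definition _ :=
  GRing.isZmodule.Build dep_prod dep_prodA dep_prodC dep_prod0D dep_prodND.

Definition direct_sum_pred : {pred dep_prod} :=
  [pred x : dep_prod | `[< finite_set [set i | x i <> 0] >]].

Fact direct_sum_zmod_closed : zmod_closed direct_sum_pred.
Proof.
split => [|x y]; rewrite !inE.
  by rewrite (_ : mkset _ = set0) // -subset0 => i /=; apply.
move=> fx fy.
have : finite_set ([set i | x i <> 0] `|` [set i | y i <> 0]).
  by rewrite finite_setU.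
apply: sub_finite_set => i /= xyi; apply: contrapT => /not_orP[].
move=> /contrapT xi /contrapT yi; apply: xyi.
by rewrite -[LHS]/(x i - y i) xi yi subr0.
Qed.
HB.instance Definition _ :=
  GRing.isZmodClosed.Build _ direct_sum_pred direct_sum_zmod_closed.

Record direct_sum := DirectSum {
  direct_sum_val :> dep_prod;
  direct_sumP : direct_sum_val \in direct_sum_pred }.
HB.instance Definition _ := [isSub for direct_sum_val].
HB.instance Definition _ := [Choice of direct_sum by <:].
HB.instance Definition _ := [SubChoice_isSubZmodule of direct_sum by <:].

Definition dep_prod_inj i (x : A i) : dep_prod := fun j =>
  if pselect (i = j) is left ij then eq_rect i A x j ij else 0.

Fact dep_prod_inj_subproof i (x : A i) : dep_prod_inj x \in direct_sum_pred.
Proof.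
rewrite inE; apply: (sub_finite_set _ (finite_set1 i)) => j /=.
by rewrite /dep_prod_inj; case: pselect.
Qed.

Definition direct_sum_inj i (x : A i) : direct_sum :=
  DirectSum (dep_prod_inj_subproof x).

Definition limit_relator : set direct_sum :=
  [set r | exists i j (phi : A i -> A j) (x : A i),
     transition phi /\ r = direct_sum_inj x - direct_sum_inj (phi x)].

Definition limit_kernel : {pred direct_sum} :=
  [pred x : direct_sum | `[< forall D : zmodClosed direct_sum,
     (forall r, limit_relator r -> r \in D) -> x \in D >]].

Fact limit_kernel_zmod_closed : zmod_closed limit_kernel.
Proof.
split => [|x y]; rewrite !inE; first by move=> D _; exact: rpred0.
move=> hx hy D hD.
by apply: rpredB; [exact: hx|exact: hy].
Qed.
HB.instance Definition _ :=
  GRing.isZmodClosed.Build _ limit_kernel limit_kernel_zmod_closed.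

Definition direct_limit : zmodType := {ideal_quot limit_kernel}.

End DirectLimit.

(** * Nerves of indexed covers and limit cohomology groups *)

Section Nerve.
Context {X V : Type} (U : V -> set X).

Definition nerve_face : set (set V) :=
  [set s | [/\ s !=set0, finite_set s & \bigcap_(v in s) U v !=set0]].

Fact nerve_face_nonempty s : nerve_face s -> s !=set0.
Proof. by case. Qed.

Fact nerve_face_finite s : nerve_face s -> finite_set s.
Proof. by case. Qed.

Fact nerve_face_sub s t : nerve_face s -> t !=set0 -> t `<=` s -> nerve_face t.
Proof.
move=> [_ fs [x Ux]] t0 ts; split => //; first exact: sub_finite_set fs.
by exists x => v /ts; exact: Ux.
Qed.

Definition nerve : simplicial_complex V :=
  SimplicialComplex nerve_face_nonempty nerve_face_finite nerve_face_sub.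

End Nerve.

Definition refinement_projection {X V W : Type} (U : V -> set X)
    (U' : W -> set X) (p : W -> V) : Prop :=
  forall w, U' w `<=` U (p w).

Fact refinement_face {X V W : Type} {U : V -> set X} {U' : W -> set X}
    {p : W -> V} (hp : refinement_projection U U' p) (s : set W) :
  face (nerve U') s -> face (nerve U) (p @` s).
Proof.
move=> [[w sw] fs [x Ux]]; split; first by exists (p w), w.
  exact: finite_image.
by exists x => _ [v sv <-]; apply: hp; exact: Ux.
Qed.

Definition nerve_map {X V W : Type} {U : V -> set X} {U' : W -> set X}
    {p : W -> V} (hp : refinement_projection U U' p) :
  simplicial_map (nerve U') (nerve U) := SimplicialMap (refinement_face hp).

Record cover_system (X : Type) := CoverSystem {
  cover_of : Type;
  cover_index : cover_of -> Type;
  cover_member : forall a : cover_of, cover_index a -> set X }.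

(* For each pair of covers, all the maps induced by the refinement projections
   are transition maps (they all agree). *)
Definition limit_cohomology {X : Type} (C : cover_system X) (n : nat)
    (G : zmodType) : zmodType :=
  let U := @cover_member X C in
  direct_limit (A := fun a => cohomology (nerve (U a)) n G)
    (fun a b => [set phi | exists (p : cover_index b -> cover_index a)
       (hp : refinement_projection (U a) (U b) p),
       phi = cohomology_map (nerve_map hp) (G := G)]).

Definition functionally_open (R : realType) {X : topologicalType} (U : set X) :
    Prop :=
  exists f : X -> R, [/\ continuous f, forall x, 0 <= f x <= 1
    & U = f @^-1` `]0, 1]].

(* Up to a bijection of index sets, the finite indexed covers are those indexed
   by 'I_k for some k. *)
Definition functional_cover (R : realType) (X : topologicalType) : Type :=
  {k : nat & {U : 'I_k -> set X |
    (forall v, functionally_open R (U v)) /\ \bigcup_v U v = setT}}.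

Definition functional_covers (R : realType) (X : topologicalType) :
    cover_system X :=
  @CoverSystem X (functional_cover R X) (fun a => 'I_(projT1 a))
    (fun a => sval (projT2 a)).

(* An open cover, as a set of open sets, is indexed by itself. *)
Definition open_cover (X : topologicalType) : Type :=
  {F : set (set X) | (forall U, F U -> open U) /\ \bigcup_(U in F) U = setT}.

Definition open_covers (X : topologicalType) : cover_system X :=
  @CoverSystem X (open_cover X) (fun a => {U : set X | sval a U})
    (fun a U => sval U).

Definition functional_cohomology (R : realType) (X : topologicalType) (n : nat)
  (G : zmodType) : zmodType := limit_cohomology (functional_covers R X) n G.

Definition cech_cohomology (X : topologicalType) (n : nat) (G : zmodType) :
  zmodType := limit_cohomology (open_covers X) n G.

(** * Coefficients of cyclicity *)

Definition trivial_group (A : zmodType) : Prop := forall x : A, x = 0.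

(* [cyclicity X H k] means that the coefficient of cyclicity of X computed with
   the groups H is defined and equal to k; it has no value when X is nonempty
   and all the H n vanish, which happens for G = 0. *)
Inductive cyclicity (X : Type) (H : nat -> zmodType) : \bar int -> Prop :=
| cyclicity_empty : (X -> False) -> cyclicity X H (-1)%:E
| cyclicity_fin (n : nat) :
    (forall m, (n < m)%N -> trivial_group (H m)) -> ~ trivial_group (H n) ->
    cyclicity X H (n%:Z)%:E
| cyclicity_infty : inhabited X ->
    (forall m, exists2 n, (m <= n)%N & ~ trivial_group (H n)) ->
    cyclicity X H +oo%E.

Definition functional_cyclicity (R : realType) (G : zmodType)
    (X : topologicalType) : \bar int -> Prop :=
  cyclicity X (fun n => functional_cohomology R X n G).

Definition cech_cyclicity (G : zmodType) (X : topologicalType) :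
    \bar int -> Prop :=
  cyclicity X (fun n => cech_cohomology X n G).

(** * The Stone-Cech compactification *)

Definition tychonoff_space (X : topologicalType) : Prop :=
  completely_regular_space X /\ hausdorff_space X.

Definition topological_embedding {X Y : topologicalType} (i : X -> Y) : Prop :=
  [/\ continuous i, injective i
    & forall U : set X, open U -> exists2 W : set Y, open W & U = i @^-1` W].

Definition compactification {X Y : topologicalType} (i : X -> Y) : Prop :=
  [/\ compact [set: Y], hausdorff_space Y, topological_embedding i
    & dense (range i)].

Definition stone_cech {X Y : topologicalType} (i : X -> Y) : Prop :=
  compactification i /\
  forall (K : topologicalType) (f : X -> K),
    compact [set: K] -> hausdorff_space K -> continuous f ->
    exists2 g : Y -> K, continuous g & forall x, g (i x) = f x.

(* Main.v *)
(* Let ext U be the largest open set of betaX with trace U on X. If U_1, ...,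
   U_k is a functional cover of X, normalizing the functions that define it
   yields a partition of unity, which extends to betaX; hence the sets ext
   U_v cover betaX, and by density they have the same nerve as the U_v. By
   compactness and complete regularity of betaX every open cover of betaX is
   refined by such a family. Passing to extensions, and conversely to
   refinements by extensions, gives compatible families of homomorphisms
   from the cohomology groups of one system to the limit of the other one,
   whose images exhaust the generators of that limit. So in each degree one
   limit group vanishes iff the other does, and the coefficients of
   cyclicity only depend on which groups vanish. *)

Require Import Defs.
From HB Require Import structures.
From mathcomp Require Import all_boot all_order perm all_algebra.
From mathcomp Require Import all_classical all_reals all_analysis.

Set Implicit Arguments.
Unset Strict Implicit.
Unset Printing Implicit Defensive.

Import Order.TTheory GRing.Theory Num.Theory.
Import numFieldNormedType.Exports.

Local Open Scope classical_set_scope.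
Local Open Scope ring_scope.
Local Open Scope quotient_scope.

(** * Alternating cochains and contiguity *)

Section PermIndex.
Variable n : nat.

Lemma perm_lift (p : 'S_n.+1) (i : 'I_n.+1) :
  exists q : 'S_n, p = lift_perm i (p i) q.
Proof.
have hq k : exists l, p (lift i k) == lift (p i) l.
  have : p (lift i k) != p i by rewrite (inj_eq perm_inj) eq_sym neq_lift.
  by rewrite eq_sym => /unlift_some[l -> _]; exists l.
pose q k := sval (sigW (hq k)).
have qE k : p (lift i k) = lift (p i) (q k).
  by apply/eqP; exact: svalP (sigW (hq k)).
have qi : injective q.
  move=> k l qkl; apply: (@lift_inj _ i); apply: (@perm_inj _ p).
  by rewrite !qE qkl.
exists (perm qi); apply/permP => j.
case: (unliftP i j) => [k ->|->]; last by rewrite lift_perm_id.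
by rewrite lift_perm_lift permE qE.
Qed.

Lemma perm_to_front (j k : 'I_n.+2) : j != k ->
  exists2 p : 'S_n.+2, p ord0 = j & p (lift ord0 ord0) = k.
Proof.
(* [r] acts first: it fixes 0, as [q k] is not 0, and sends 1 to [q k], which the involution [q]
   sends to [k]. *)
move=> jk; pose q := tperm ord0 j; pose r := tperm (lift ord0 ord0) (q k).
have qk0 : q k != ord0.
  by rewrite -(inj_eq (@perm_inj _ q)) tpermK tpermL eq_sym.
exists (r * q)%g; rewrite permM.
  by rewrite [r _]tpermD ?tpermL ?qk0 // eq_sym neq_lift.
by rewrite tpermL tpermK.
Qed.

End PermIndex.

Section AlternatingSum.
Variables (V : Type) (G : zmodType).

Definition alternating_fun n (c : ('I_n -> V) -> G) : Prop :=
  (forall (s : 'I_n -> V) (p : 'S_n), c (s \o p) = c s *~ (-1) ^+ odd_perm p) /\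
  (forall s : 'I_n -> V, ~ injective s -> c s = 0).

(** [F] sees the removed entry and the remaining ones, so one computation serves both the
    coboundary, which ignores the removed entry, and the prism. The sign of [p] is the product of
    the two position signs and the sign of the induced permutation. *)
Lemma alternating_sum_perm n (F : V -> ('I_n -> V) -> G)
    (s : 'I_n.+1 -> V) (p : 'S_n.+1) :
  (forall x u (q : 'S_n), F x (u \o q) = F x u *~ (-1) ^+ odd_perm q) ->
  \sum_(i < n.+1) F (s (p i)) (s \o p \o lift i) *~ (-1) ^+ i =
  (\sum_(i < n.+1) F (s i) (s \o lift i) *~ (-1) ^+ i) *~ (-1) ^+ odd_perm p.
Proof.
move=> Fq; rewrite [in RHS](reindex_inj (@perm_inj _ p)) /= mulrz_suml.
apply: eq_bigr => i _; have [q pq] := perm_lift p i.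
have -> : s \o p \o lift i = s \o lift (p i) \o q.
  by apply/funext => k /=; rewrite [in LHS]pq lift_perm_lift.
rewrite Fq -!mulrzA; congr (_ *~ _).
have -> : odd_perm p = odd i (+) odd (p i) (+) odd_perm q.
  by rewrite [in LHS]pq odd_lift_perm.
rewrite -[_ ^+ i]signr_odd -[_ ^+ p i]signr_odd -!signr_addb; congr (_ ^+ _).
by case: odd; case: odd; case: odd_perm.
Qed.

End AlternatingSum.

Lemma not_injectiveP (T U : Type) (s : T -> U) :
  ~ injective s -> exists2 jk : T * T, jk.1 <> jk.2 & s jk.1 = s jk.2.
Proof.
move=> si; apply: contrapT => h; apply: si => j k sjk; apply: contrapT => jk.
by apply: h; exists (j, k).
Qed.

(** * Cochains extended by zero and their coboundaries *)

Section OrderedCochain.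
Variables (V : Type) (K : simplicial_complex V) (G : zmodType).

(* Extension by zero, which avoids carrying proofs that the sequences of
   vertices span simplices. *)
Definition cochain_ext n (c : osimplex K n -> G) (s : 'I_n.+1 -> V) : G :=
  if pselect (face K (range s)) is left h then c (OSimplex h) else 0.

Lemma cochain_extE n (c : osimplex K n -> G) (s : osimplex K n) :
  cochain_ext c s = c s.
Proof.
rewrite /cochain_ext; case: pselect => [h|]; last by case: s.
by congr c; exact: osimplex_eq.
Qed.

Lemma cochain_ext_face n (c : osimplex K n -> G) (s : 'I_n.+1 -> V)
  (h : face K (range s)) : cochain_ext c s = c (OSimplex h).
Proof. by rewrite -cochain_extE. Qed.

Lemma cochain_ext_out n (c : osimplex K n -> G) (s : 'I_n.+1 -> V) :
  ~ face K (range s) -> cochain_ext c s = 0.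
Proof. by rewrite /cochain_ext; case: pselect. Qed.

Lemma cochain_ext_alternating n (c : osimplex K n -> G) :
  alternating_cochain c -> alternating_fun (cochain_ext c).
Proof.
move=> [c1 c2]; split=> [s p|s si].
  have rs : range (s \o p) = range s.
    apply/seteqP; split => _ [i _ <-]; first by exists (p i).
    by exists ((p^-1)%g i) => //=; rewrite permKV.
  have [h|h] := pselect (face K (range s)).
    rewrite (cochain_ext_face _ h) -c1.
    by rewrite -[RHS]cochain_extE.
  by rewrite !cochain_ext_out ?rs // mul0rz.
rewrite /cochain_ext; case: pselect => // h.
exact: c2.
Qed.

Lemma coboundary_ext n (c : osimplex K n -> G) (s : osimplex K n.+1) :
  coboundary c s = \sum_(i < n.+2) cochain_ext c (s \o lift i) *~ (-1) ^+ i.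
Proof. by apply: eq_bigr => i _; rewrite -cochain_extE. Qed.

Lemma coboundary_alternating n (c : osimplex K n -> G) :
  alternating_cochain c -> alternating_cochain (coboundary c).
Proof.
move=> /cochain_ext_alternating[c1 c2].
have perm_cob (s : osimplex K n.+1) (p : 'S_n.+2) :
    coboundary c (osimplex_reindex s p) = coboundary c s *~ (-1) ^+ odd_perm p.
  rewrite !coboundary_ext.
  by rewrite -(@alternating_sum_perm _ _ _ (fun=> cochain_ext c)).
split; first exact: perm_cob.
move=> s si; have [[j k] /= /eqP jk sjk] := not_injectiveP si.
(* A permutation costs only a sign, so the repeated vertex may be moved to positions 0 and 1. *)
have [p pj pk] := perm_to_front jk.
suff : coboundary c (osimplex_reindex s p) = 0.
  rewrite perm_cob; case: odd_perm; last by rewrite expr0 mulr1z.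
  by rewrite expr1 mulrN1z => /eqP; rewrite oppr_eq0 => /eqP.
rewrite coboundary_ext.
set t := vertex (osimplex_reindex s p).
have t01 : t ord0 = t (lift ord0 ord0) by rewrite /t /= pj pk.
(* The faces omitting position 0 or 1 coincide and carry opposite signs; every other face keeps both
   copies and is killed by alternation. *)
rewrite 2!big_ord_recl /= big1 ?addr0 => [|i _].
  have -> : t \o lift ord0 = t \o lift (lift ord0 ord0).
    apply/funext => i /=; case: (unliftP ord0 i) => [l ->|->].
      by congr t; exact: val_inj.
    rewrite -t01; congr t; exact: val_inj.
  by rewrite expr0 expr1 mulr1z mulrN1z subrr.
rewrite c2 ?mul0rz // => ti.
(* A face index beyond the first two forces [n] to be positive, so position 1 exists in the face. *)
have n1 : (1 < n.+1)%N by case: (i) => m /=; case: (n).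
have /(congr1 val) // : ord0 = Ordinal n1 :> 'I_n.+1.
apply: ti; transitivity (t ord0); first by congr t; exact: val_inj.
by rewrite t01; congr t; exact: val_inj.
Qed.
End OrderedCochain.

(** * Prepending a vertex to a sequence *)

Section FunCons.
Variable V : Type.

Definition fcons n (x : V) (u : 'I_n -> V) (i : 'I_n.+1) : V :=
  if unlift ord0 i is Some j then u j else x.

Lemma fcons0 n x (u : 'I_n -> V) : fcons x u ord0 = x.
Proof. by rewrite /fcons unlift_none. Qed.

Lemma fconsS n x (u : 'I_n -> V) j : fcons x u (lift ord0 j) = u j.
Proof. by rewrite /fcons liftK. Qed.

Lemma fcons_eta n (s : 'I_n.+1 -> V) : fcons (s ord0) (s \o lift ord0) = s.
Proof.
by apply/funext => i; case: (unliftP ord0 i) => [j ->|->]; rewrite ?fcons0 ?fconsS.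
Qed.

Lemma fcons_lift0 n x (u : 'I_n -> V) : fcons x u \o lift ord0 = u.
Proof. by apply/funext => i /=; rewrite fconsS. Qed.

Lemma lift_lift0 n (j : 'I_n.+1) (k : 'I_n) :
  lift (lift ord0 j) (lift ord0 k) = lift ord0 (lift j k).
Proof. by apply: val_inj; rewrite /= /bump leq_add2l addnCA. Qed.

Lemma lift_lift00 n (j : 'I_n.+1) : lift (lift ord0 j) ord0 = ord0.
Proof. exact: val_inj. Qed.

Lemma fcons_lift n x (u : 'I_n.+1 -> V) j :
  fcons x u \o lift (lift ord0 j) = fcons x (u \o lift j).
Proof.
apply/funext => i /=; case: (unliftP ord0 i) => [k ->|->].
  by rewrite lift_lift0 !fconsS.
by rewrite lift_lift00 !fcons0.
Qed.

Lemma fcons_perm n x (u : 'I_n -> V) (q : 'S_n) :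
  fcons x (u \o q) = fcons x u \o lift_perm ord0 ord0 q.
Proof.
apply/funext => i /=; case: (unliftP ord0 i) => [k ->|->].
  by rewrite lift_perm_lift !fconsS.
by rewrite lift_perm_id !fcons0.
Qed.

End FunCons.

(** * Chain homotopy for contiguous maps that differ at one vertex *)

Section ContiguousStep.
Variables (V W : Type) (K : simplicial_complex W) (L : simplicial_complex V).
Variables (f g : simplicial_map K L) (w0 : W) (G : zmodType).
Hypothesis fg : forall w, w <> w0 -> f w = g w.
Hypothesis contiguous : forall s, face K s -> face L (f @` s `|` g @` s).

(* The prism on [t] doubles the vertex [w0], which occurs at most once when [t] is
   injective. The two copies [f w0] and [g w0] are put in front instead of at the
   position of [w0], so that alternation follows as for coboundaries. *)
Section Prism.
Variables (m : nat) (c : osimplex L m.+1 -> G).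
Hypotheses (altc : alternating_cochain c) (dc0 : coboundary c = 0).

Definition prism_term (x : W) (u : 'I_m -> W) : G :=
  if `[< x = w0 >] then
    cochain_ext c (fcons (f w0) (fcons (g w0) (f \o u)))
  else 0.

Definition prism_fun (t : 'I_m.+1 -> W) : G :=
  \sum_(i < m.+1) prism_term (t i) (t \o lift i) *~ (-1) ^+ i.

Definition prism (t : osimplex K m) : G := prism_fun t.

Lemma prism_term_neq x u : x <> w0 -> prism_term x u = 0.
Proof. by rewrite /prism_term; case: asboolP. Qed.

Lemma prism_term_perm x u (q : 'S_m) :
  prism_term x (u \o q) = prism_term x u *~ (-1) ^+ odd_perm q.
Proof.
rewrite /prism_term; case: asboolP => _; last by rewrite mul0rz.
rewrite compA !fcons_perm (cochain_ext_alternating altc).1.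
by rewrite !odd_lift_perm.
Qed.

Lemma prism_alternating : alternating_cochain prism.
Proof.
split=> [s p|s si].
  exact: alternating_sum_perm prism_term_perm.
have [[j k] /= jk sjk] := not_injectiveP si.
apply: big1 => i _; have [siw|siw] := pselect (s i = w0); last first.
  by rewrite prism_term_neq ?mul0rz.
rewrite /prism_term; case: asboolP => // _.
rewrite (cochain_ext_alternating altc).2 ?mul0rz // => ci.
wlog ik : j k jk sjk / i <> k => [h|].
  have [ik|] := pselect (i = k); last exact: h jk sjk.
  apply: (h k j (nesym jk) (esym sjk)).
  by rewrite ik => /esym.
have /eqP/unlift_some[k' kE _] := ik.
have [ij|/eqP/unlift_some[j' jE _]] := pselect (i = j).
  suff /ci : fcons (f w0) (fcons (g w0) (f \o (s \o lift i))) ord0 =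
    fcons (f w0) (fcons (g w0) (f \o (s \o lift i))) (lift ord0 (lift ord0 k')).
    by move/eqP; rewrite (negbTE (neq_lift _ _)).
  by rewrite fcons0 !fconsS /= -kE -sjk -ij siw.
suff /ci : fcons (f w0) (fcons (g w0) (f \o (s \o lift i)))
      (lift ord0 (lift ord0 j')) =
    fcons (f w0) (fcons (g w0) (f \o (s \o lift i))) (lift ord0 (lift ord0 k')).
  by move=> /lift_inj/lift_inj jk'; apply: jk; rewrite jE kE jk'.
by rewrite !fconsS /= -kE -jE sjk.
Qed.

(** The cocycle condition is evaluated on [e]: the vertices [f w0] and [g w0], then the common
    images of the other vertices, a simplex by contiguity. Its first two faces are the images of [s]
    under [g] and [f]; the others are the prism terms. *)
Lemma coboundary_prism_front (s : osimplex K m.+1) :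
  injective s -> s ord0 = w0 ->
  coboundary prism s = pullback g c s - pullback f c s.
Proof.
move=> si s0; pose u : 'I_m.+1 -> W := s \o lift ord0.
have uw k : u k <> w0.
  by rewrite -s0 => /si/eqP; rewrite eq_sym (negbTE (neq_lift _ _)).
pose e := fcons (f w0) (fcons (g w0) (f \o u)).
have eface : face L (range e).
  apply: face_sub (contiguous (osimplex_face s)) _ _; first by exists (e ord0), ord0.
  move=> _ [i _ <-]; rewrite /e; case: (unliftP ord0 i) => [j ->|->].
    rewrite fconsS; case: (unliftP ord0 j) => [k ->|->]; rewrite ?fconsS ?fcons0.
      by left; exists (u k) => //; exists (lift ord0 k).
    by right; exists w0 => //; exists ord0.
  by rewrite fcons0; left; exists w0 => //; exists ord0.
have := congr1 (fun h => h (OSimplex eface)) dc0.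
rewrite coboundary_ext /= big_ord_recl big_ord_recl /=.
rewrite fcons_lift0 fcons_lift fcons_lift0.
have -> : fcons (g w0) (f \o u) = g \o s.
  rewrite -[g \o s]fcons_eta /= s0; congr fcons.
  by apply/funext => k /=; exact: fg (uw k).
have -> : fcons (f w0) (f \o u) = f \o s by rewrite -[f \o s]fcons_eta /= s0.
rewrite -[cochain_ext c (g \o s)]/(cochain_ext c (osimplex_map g s)).
rewrite -[cochain_ext c (f \o s)]/(cochain_ext c (osimplex_map f s)).
rewrite !cochain_extE -!/(pullback _ c s).
rewrite expr0 mulr1z expr1 mulrN1z addrA => /eqP; rewrite addr_eq0 => /eqP e0.
rewrite e0 -sumrN.
(* The face omitting position 0 has lost [w0], so its prism vanishes. *)
rewrite /coboundary big_ord_recl {1}/prism /prism_fun big1 ?mul0rz ?add0r; last first.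
  by move=> i _; rewrite prism_term_neq ?mul0rz //; exact: uw.
apply: eq_bigr => j _.
(* The remaining faces have [w0] in front, and only the summand removing it survives. *)
rewrite /prism /prism_fun big_ord_recl big1 ?addr0; last first.
  move=> i _; rewrite prism_term_neq ?mul0rz //= lift_lift0; exact: uw.
rewrite expr0 mulr1z /prism_term /= lift_lift00; case: asboolP => // _.
rewrite !fcons_lift.
have -> : f \o (s \o lift (lift ord0 j) \o lift ord0) = f \o u \o lift j.
  by apply/funext => k /=; rewrite lift_lift0.
by rewrite /bump !add1n exprS mulN1r mulrNz exprS exprS !mulN1r opprK.
Qed.

(** Both sides alternate, so only injective sequences matter, and [w0] can be moved to the front.
    Where [w0] does not occur, [f] and [g] agree and no prism term is left. *)
Lemma coboundary_prism (s : osimplex K m.+1) :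
  coboundary prism s = pullback g c s - pullback f c s.
Proof.
pose D (s : osimplex K m.+1) := coboundary prism s - (pullback g c - pullback f c) s.
suff : D s = 0 by move/eqP; rewrite subr_eq0 => /eqP.
have [D1 D2] : alternating_cochain D.
  apply: alternating_cochainB; first exact: coboundary_alternating prism_alternating.
  by apply: alternating_cochainB; exact: pullback_alternating.
have [si|/D2//] := pselect (injective s).
have [[i siw]|sw] := pselect (exists i, s i = w0).
  have : D (osimplex_reindex s (tperm ord0 i)) = 0.
    rewrite /D coboundary_prism_front /=; first exact: subrr.
      by move=> j k /= /si/perm_inj.
    by rewrite tpermL.
  rewrite D1; case: odd_perm; last by rewrite expr0 mulr1z.
  by rewrite expr1 mulrN1z => /eqP; rewrite oppr_eq0 => /eqP.
have sw0 k : s k <> w0 by move=> skw; apply: sw; exists k.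
rewrite /D -[X in _ - X]/(pullback g c s - pullback f c s) /pullback.
rewrite (_ : osimplex_map g s = osimplex_map f s); last first.
  by apply: osimplex_eq => k /=; rewrite fg.
rewrite subrr subr0; apply: big1 => i _.
rewrite /prism /prism_fun big1 ?mul0rz // => j _.
by rewrite prism_term_neq ?mul0rz //=.
Qed.

End Prism.

Lemma pullback_contiguous n (c : osimplex L n -> G) :
  alternating_cochain c -> coboundary c = 0 ->
  is_coboundary (pullback g c - pullback f c).
Proof.
case: n c => [|m] c altc dc0; last first.
  exists (prism c); first exact: prism_alternating.
  by apply/funext => s; exact: coboundary_prism.
apply/funext => s /=; rewrite -[LHS]/(pullback g c s - pullback f c s).
(* Degree 0 has no prism: the cocycle condition on the possibly degenerate edge joining the two
   images of the vertex gives equality outright. *)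
pose e := fcons (f (s ord0)) (fcons (g (s ord0)) (fun j : 'I_0 => f (s ord0))).
have eface : face L (range e).
  apply: face_sub (contiguous (osimplex_face s)) _ _; first by exists (e ord0), ord0.
  move=> _ [i _ <-]; rewrite /e; case: (unliftP ord0 i) => [j ->|->].
    rewrite fconsS; case: (unliftP ord0 j) => [[] //|->]; rewrite fcons0.
    by right; exists (s ord0) => //; exists ord0.
  by rewrite fcons0; left; exists (s ord0) => //; exists ord0.
rewrite -[RHS]/((0 : osimplex L 1 -> G) (OSimplex eface)) -dc0.
rewrite coboundary_ext !big_ord_recl big_ord0 /= addr0.
rewrite expr0 mulr1z expr1 mulrN1z.
rewrite /pullback -!(cochain_extE c); congr (_ - _); congr cochain_ext.
  by apply/funext => i /=; rewrite (ord1 i) /e /= fconsS fcons0.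
apply/funext => i /=; rewrite (ord1 i) /=.
by rewrite (_ : lift _ _ = ord0) /e ?fcons0 //; exact: val_inj.
Qed.

Lemma cohomology_map_step n (x : cohomology L n G) :
  cohomology_map f x = cohomology_map g x.
Proof.
rewrite /cohomology_map /cohomology_class; apply/eqP.
rewrite eq_sym -Quotient.idealrBE inE /=.
have := cocycleP (repr x); rewrite inE => -[ac dc].
exact: pullback_contiguous.
Qed.

End ContiguousStep.

(** * Functoriality and direct limits *)

Section CohomologyFunctor.
Variables (n : nat) (G : zmodType).

Lemma cohomology_ind V (K : simplicial_complex V) (P : cohomology K n G -> Prop) :
  (forall c, P (cohomology_class c)) -> forall x, P x.
Proof. by move=> Pc x; rewrite -[x]reprK; exact: Pc. Qed.

Lemma cohomology_classB V (K : simplicial_complex V) (b c : cocycle K n G) :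
  cohomology_class (b - c) = cohomology_class b - cohomology_class c.
Proof. exact: raddfB. Qed.

Lemma cohomology_mapB V W (K : simplicial_complex V) (L : simplicial_complex W)
    (f : simplicial_map K L) (x y : cohomology L n G) :
  cohomology_map f (x - y) = cohomology_map f x - cohomology_map f y.
Proof.
elim/cohomology_ind: x => b; elim/cohomology_ind: y => c.
rewrite -cohomology_classB !cohomology_mapE -cohomology_classB.
by congr cohomology_class; exact: val_inj.
Qed.

Lemma cohomology_map_comp V1 V2 V3 (K : simplicial_complex V1)
    (L : simplicial_complex V2) (M : simplicial_complex V3)
    (f : simplicial_map K L) (g : simplicial_map L M) (h : simplicial_map K M)
    (x : cohomology M n G) :
  (forall v, g (f v) = h v) ->
  cohomology_map f (cohomology_map g x) = cohomology_map h x.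
Proof.
move=> gf; elim/cohomology_ind: x => c; rewrite !cohomology_mapE.
congr cohomology_class; apply: val_inj; apply/funext => s /=.
by rewrite /pullback; congr (cocycle_val c _); apply: osimplex_eq => i /=.
Qed.

Lemma eq_cohomology_map V W (K : simplicial_complex V) (L : simplicial_complex W)
    (f g : simplicial_map K L) (x : cohomology L n G) :
  f =1 g -> cohomology_map f x = cohomology_map g x.
Proof.
move=> fg; elim/cohomology_ind: x => c; rewrite !cohomology_mapE.
congr cohomology_class; apply: val_inj; apply/funext => s /=.
by rewrite /pullback; congr (cocycle_val c _); apply: osimplex_eq => i /=.
Qed.

(* Refinement projections of a finite cover are exchanged one vertex at a
   time. *)
Lemma cohomology_map_refinement X V k (U : V -> set X) (U' : 'I_k -> set X)
    (p q : 'I_k -> V) (hp : refinement_projection U U' p)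
    (hq : refinement_projection U U' q) (x : cohomology (nerve U) n G) :
  cohomology_map (nerve_map hp) x = cohomology_map (nerve_map hq) x.
Proof.
pose r j (v : 'I_k) := if (v < j)%N then q v else p v.
have hr j : refinement_projection U U' (r j).
  by move=> v; rewrite /r; case: ifP => _; [exact: hq|exact: hp].
have -> : cohomology_map (nerve_map hp) x = cohomology_map (nerve_map (hr 0%N)) x.
  exact: eq_cohomology_map.
have -> : cohomology_map (nerve_map hq) x = cohomology_map (nerve_map (hr k)) x.
  by apply: eq_cohomology_map => v /=; rewrite /r ltn_ord.
suff h j : (j <= k)%N ->
    cohomology_map (nerve_map (hr 0%N)) x = cohomology_map (nerve_map (hr j)) x.
  exact: h.
elim: j => [//|j IHj] jk; rewrite (IHj (ltnW jk)).
(* Stages [j] and [j.+1] differ at vertex [j] only. A point common to the members indexed by [s]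
   lies in the members assigned to them by both stages, whence contiguity. *)
apply: (@cohomology_map_step _ _ _ _ _ _ (Ordinal jk)) => [v vj /=|s].
  rewrite /r ltnS [in RHS]leq_eqVlt.
  by case: eqP => //= vj'; case: vj; exact: val_inj.
move=> [[w sw] fs [y Uy]]; split; first by exists (r j w); left; exists w.
  by rewrite finite_setU; split; exact: finite_image.
by exists y => _ [|] [v sv <-] /=; apply: (hr _ v); exact: Uy.
Qed.

End CohomologyFunctor.

Definition dep_prod_fun I (A : I -> zmodType) (x : dep_prod A) : forall i, A i := x.
Coercion dep_prod_fun : dep_prod >-> Funclass.

(** * Generators and descent for direct limits *)

Section DirectLimitTheory.
Variables (I : Type) (A : I -> zmodType).
Variable transition : forall i j, set (A i -> A j).

Lemma direct_sum_eq (x y : direct_sum A) : (forall i, x i = y i) -> x = y.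
Proof.
by move=> xy; apply: val_inj; apply: functional_extensionality_dep.
Qed.

Lemma direct_sumBE (x y : direct_sum A) i : (x - y) i = x i - y i.
Proof. by []. Qed.

Lemma direct_sum_injE i (x : A i) : direct_sum_inj x i = x.
Proof.
rewrite /dep_prod_fun /= /dep_prod_inj; case: pselect => // ii.
by rewrite (Prop_irrelevance ii erefl).
Qed.

Lemma direct_sum_inj_neq i j (x : A i) : i <> j -> direct_sum_inj x j = 0.
Proof. by rewrite /dep_prod_fun /= /dep_prod_inj; case: pselect. Qed.

Lemma direct_sum_injB i (x y : A i) :
  direct_sum_inj (x - y) = direct_sum_inj x - direct_sum_inj y.
Proof.
apply: direct_sum_eq => j; rewrite direct_sumBE.
have [<-|ij] := pselect (i = j); first by rewrite !direct_sum_injE.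
by rewrite !(direct_sum_inj_neq _ ij) subr0.
Qed.

Lemma direct_sum_support (x : direct_sum A) : finite_set [set i | x i <> 0].
Proof. by have := direct_sumP x; rewrite inE. Qed.

(** Induction on a list containing the support. Closure under differences suffices, since negation
    is a difference from 0. *)
Lemma direct_sum_ind (P : direct_sum A -> Prop) :
  P 0 -> (forall x y, P x -> P y -> P (x - y)) ->
  (forall i (x : A i), P (direct_sum_inj x)) -> forall x, P x.
Proof.
move=> P0 PB Pinj x.
have /(@finite_seqP {classic I})[s xs] := direct_sum_support x.
have {xs} : forall i : {classic I}, x i <> 0 -> i \in s.
  by move=> i xi; have : [set i | x i <> 0] i by []; rewrite xs.
elim: s x => [x x0|a s IHs x xs].
  suff -> : x = 0 by [].
  by apply: direct_sum_eq => i; apply: contrapT => /x0.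
have -> : x = (x - direct_sum_inj (x a)) - (0 - direct_sum_inj (x a)).
  by rewrite sub0r opprK subrK.
apply: (PB); last by apply: (PB).
apply: IHs => i; rewrite direct_sumBE.
have [<-|ai] := pselect (a = i); first by rewrite direct_sum_injE subrr.
rewrite (direct_sum_inj_neq _ ai) subr0 => /xs; rewrite inE.
by case: eqP => // ia; case: ai.
Qed.

Definition limit_inj i (x : A i) : direct_limit transition :=
  \pi_({ideal_quot limit_kernel transition}) (direct_sum_inj x).

Lemma limit_injB i (x y : A i) : limit_inj (x - y) = limit_inj x - limit_inj y.
Proof. by rewrite /limit_inj direct_sum_injB raddfB. Qed.

Lemma limit_inj_transition i j (phi : A i -> A j) x :
  transition phi -> limit_inj (phi x) = limit_inj x.
Proof.
move=> tphi; apply/eqP; rewrite eq_sym /limit_inj -Quotient.idealrBE inE.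
by move=> D; apply; exists i, j, phi, x.
Qed.

Lemma trivial_direct_limit :
  (forall i (x : A i), limit_inj x = 0) -> trivial_group (direct_limit transition).
Proof.
move=> h x; rewrite -[x]reprK; elim/direct_sum_ind: (repr x).
- exact: raddf0.
- by move=> y z yE zE; rewrite raddfB /= yE zE subr0.
- exact: h.
Qed.

Section Universal.
Variables (H : zmodType) (theta : forall i, A i -> H).
Hypothesis thetaB : forall i (x y : A i), theta (x - y) = theta x - theta y.
Hypothesis theta_transition : forall i j (phi : A i -> A j) x,
  transition phi -> theta (phi x) = theta x.

Definition direct_sum_desc (x : direct_sum A) : H :=
  \sum_(i \in [set: {classic I}]) theta (x i).

Lemma theta0 i : theta (0 : A i) = 0.
Proof. by rewrite -(subrr 0) thetaB subrr. Qed.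

Lemma direct_sum_descE (P : set {classic I}) (x : direct_sum A) :
  [set i | x i <> 0] `<=` P -> direct_sum_desc x = \sum_(i \in P) theta (x i).
Proof.
move=> xP; apply/esym/fsbig_widen => // i [_ Pi] /=.
suff -> : x i = 0 by exact: theta0.
by apply: contrapT => /xP.
Qed.

Lemma direct_sum_descB x y :
  direct_sum_desc (x - y) = direct_sum_desc x - direct_sum_desc y.
Proof.
apply/eqP; rewrite eq_sym subr_eq; apply/eqP.
pose P : set {classic I} := [set i | x i <> 0] `|` [set i | y i <> 0].
have Pfin : finite_set P by rewrite finite_setU; split; exact: direct_sum_support.
rewrite !(@direct_sum_descE P).
- rewrite -fsbig_split //; apply: eq_fsbigr => i _.
  by rewrite direct_sumBE thetaB /= subrK.
- by move=> i yi; right.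
- move=> i xyi; apply: contrapT => /not_orP[/= /contrapT xi /contrapT yi].
  by apply: xyi; rewrite direct_sumBE xi yi subr0.
- by move=> i xi; left.
Qed.

Lemma direct_sum_desc_inj i (x : A i) : direct_sum_desc (direct_sum_inj x) = theta x.
Proof.
rewrite (@direct_sum_descE [set (i : {classic I})]) => [|j /=].
  by rewrite fsbig_set1 direct_sum_injE.
by move=> ij; apply: contrapT => ji; apply: ij; apply: direct_sum_inj_neq => /esym.
Qed.

Definition desc_kernel : {pred direct_sum A} :=
  [pred x : direct_sum A | `[< direct_sum_desc x = 0 >]].

Fact desc_kernel_zmod_closed : zmod_closed desc_kernel.
Proof.
split => [|x y]; rewrite !inE.
  by rewrite -[X in direct_sum_desc X](subrr 0) direct_sum_descB subrr.
by rewrite direct_sum_descB => -> ->; rewrite subr0.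
Qed.
HB.instance Definition _ :=
  GRing.isZmodClosed.Build _ desc_kernel desc_kernel_zmod_closed.

(** The limit kernel is the intersection of all subgroups containing the relators, and [desc_kernel]
    is one of them; no homomorphism on the quotient has to be built. *)
Lemma limit_inj_eq0 i (x : A i) : limit_inj x = 0 -> theta x = 0.
Proof.
move=> /eqP; rewrite -(raddf0 \pi_({ideal_quot limit_kernel transition})).
rewrite /limit_inj -Quotient.idealrBE subr0 inE => /(_ desc_kernel).
rewrite inE direct_sum_desc_inj; apply=> _ [j [k [phi [y [tphi ->]]]]].
by rewrite inE direct_sum_descB !direct_sum_desc_inj theta_transition // subrr.
Qed.

End Universal.
End DirectLimitTheory.

(** * Extending functional covers to the compactification *)

(** The universal property in [stone_cech] needs a compact Hausdorff target, so the interval is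
    treated as a space of its own. A filter on it is pushed forward to the line, and a cluster point
    found there is pulled back. *)
Lemma compact_unit_interval (R : realType) : compact [set: (`[0, 1]%classic : set R)].
Proof.
move=> F FF _.
pose I01 : set R := `[0, 1]%classic.
have F01 : F ((set_val : I01 -> R) @^-1` I01).
  by apply: filterE => x; exact: set_valP.
have [p [p01 clp]] := @segment_compact R 0 1 (fmap (set_val : I01 -> R) F) _ F01.
exists (exist _ p (mem_set p01) : I01); split => // A B FA.
case=> _ [[W oW <-] /= Wp] WB.
have FvA : F ((set_val : I01 -> R) @^-1` (set_val @` A)).
  by apply: filterS FA => a Aa; exists a.
have [_ [[a Aa <-] Wa]] := clp _ _ FvA (open_nbhs_nbhs (conj oW Wp)).
by exists a; split => //; exact: WB.
Qed.

Lemma hausdorff_unit_interval (R : realType) :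
  hausdorff_space (`[0, 1]%classic : set R).
Proof.
move=> p q pq; apply: val_inj; apply: Rhausdorff => A B pA qB.
have cval : continuous (set_val : (`[0, 1]%classic : set R) -> R).
  exact: initial_continuous.
by have [r [Ar Br]] := pq _ _ (cval p A pA) (cval q B qB); exists (set_val r).
Qed.

(* The library states [compact_cover] for pointed spaces only. *)
Lemma compact_pointwise_cover (Y : topologicalType) (O : Y -> set Y) :
  compact [set: Y] -> (forall y, O y y) -> (forall y, open (O y)) ->
  exists s : seq {classic Y}, forall z, exists2 y, y \in s & O y z.
Proof.
move=> cptY Oy oO.
have [[y0 _]|Y0] := pselect (exists y : Y, True); last first.
  by exists [::] => z; case: Y0; exists z.
pose Yp : ptopologicalType := HB.pack Y (isPointed.Build Y y0).
have : @cover_compact Yp [set: Yp] by rewrite -compact_cover.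
move=> /(_ {classic Y} setT O (fun y _ => oO y))[y _|D _ DY].
  by exists y => //; exact: Oy.
by exists (finmap.enum_fset D) => z; have [y /= yD Oz] := DY z I; exists y.
Qed.

Section StoneCech.
Variables (R : realType) (X Y : topologicalType) (i : X -> Y).
Hypothesis iSC : stone_cech i.

Lemma stone_cech_extend (f : X -> R) :
  continuous f -> (forall x, 0 <= f x <= 1) ->
  exists2 g : Y -> R, continuous g & forall x, g (i x) = f x.
Proof.
move=> cf f01.
pose I01 : set R := `[0, 1]%classic.
have f01' x : f x \in I01 by rewrite inE /I01 /= in_itv /=.
pose f' x : I01 := exist _ (f x) (f01' x).
have cf' : continuous f'.
  by apply: (@continuous_comp_initial _ _ _ (set_val : I01 -> R)).
have [g cg gi] := iSC.2 I01 f' (@compact_unit_interval R)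
  (@hausdorff_unit_interval R) cf'.
exists (set_val \o g) => [y|x /=]; last by rewrite gi.
apply: continuous_comp; first exact: cg.
exact: (@initial_continuous _ _ (set_val : I01 -> R)).
Qed.

Lemma stone_cech_dense (W : set Y) : open W -> W !=set0 -> exists x, W (i x).
Proof.
move=> oW W0; have [[_ _ _ di] _] := iSC.
by have [z [Wz [x _ xz]]] := di W W0 oW; exists x; rewrite xz.
Qed.

Lemma stone_cech_continuous : continuous i.
Proof. by have [[_ _ []]] := iSC. Qed.

(* The largest open set with trace contained in [U]. *)
Definition ext (U : set X) : set Y := ~` closure (i @` (~` U)).

Lemma open_ext U : open (ext U).
Proof. by apply: closed_openC; exact: closed_closure. Qed.

Lemma ext_trace U x : ext U (i x) -> U x.
Proof.
by move=> eUx; apply: contrapT => Ux; apply: eUx; apply: subset_closure; exists x.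
Qed.

Lemma sub_ext (W : set Y) U : open W -> (forall x, W (i x) -> U x) -> W `<=` ext U.
Proof.
move=> oW WU y Wy cy.
have [z [[x Ux xz] Wz]] := cy W (open_nbhs_nbhs (conj oW Wy)).
by apply: Ux; apply: WU; rewrite xz.
Qed.

Lemma ext_subset U U' : U `<=` U' -> ext U `<=` ext U'.
Proof. by move=> UU'; apply: sub_ext (open_ext U) _ => x /ext_trace/UU'. Qed.

Lemma trace_ext U : open U -> forall x, U x -> ext U (i x).
Proof.
move=> oU x Ux; have [[_ _ [_ _ emb] _] _] := iSC.
have [W oW UW] := emb U oU; rewrite UW in Ux.
by apply: (sub_ext oW) Ux => x' Wx'; rewrite UW.
Qed.

Lemma functionally_open_open (U : set X) : functionally_open R U -> open U.
Proof.
move=> [f [cf f01 ->]].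
rewrite (_ : _ @^-1` _ = f @^-1` [set r | 0 < r]).
  by apply: open_comp => [x _|]; [exact: cf|exact: open_gt].
apply/seteqP; split => x /=; rewrite in_itv /=; first by case/andP.
by move=> ->; case/andP: (f01 x).
Qed.

(** Without normalization the sum of the functions is positive on X, but its extension could vanish
    on the remainder. The normalized sum is constantly 1, which persists by density. *)
Lemma ext_functional_cover k (U : 'I_k -> set X) :
  (forall v, functionally_open R (U v)) -> \bigcup_v U v = setT ->
  \bigcup_v ext (U v) = setT.
Proof.
move=> /choice[f fU] Ucov.
pose S x := \sum_v f v x.
have f0 v x : 0 <= f v x by have [_ /(_ x)/andP[]] := fU v.
have S0 x : 0 < S x.
  have [v _] : (\bigcup_v U v) x by rewrite Ucov.
  have [_ _ ->] := fU v; rewrite /= in_itv /= => /andP[fvx _].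
  rewrite /S (bigD1 v) //=; apply: ltr_wpDr => //.
  by apply: sumr_ge0.
have cS : continuous S.
  apply: (@continuous_big _ _ +%R 0) => [|v _]; last by have [] := fU v.
  exact: add_continuous.
have /choice[g gE] v : exists g : Y -> R,
    continuous g /\ forall x, g (i x) = f v x / S x.
  have [cf f01 _] := fU v.
  (* [S x] has [f v x] among its nonnegative summands, so the quotient takes values in the unit
     interval and extends. *)
  have [|x|g cg gi] := @stone_cech_extend (fun x => f v x / S x).
  - move=> x; apply: cvgM; first exact: cf.
    by apply: cvgV; [rewrite (gt_eqF (S0 x))|exact: cS].
  - rewrite divr_ge0 ?(ltW (S0 x)) //= ler_pdivrMr // mul1r /S (bigD1 v) //=.
    by rewrite lerDl sumr_ge0.
  - by exists g.
have sum1 y : \sum_v g v y = 1.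
  apply: contrapT => gy.
  have oW : open [set y | \sum_v g v y != 1].
    rewrite -[mkset _]/((fun y => \sum_v g v y) @^-1` [set r | r != 1]).
    apply: open_comp => [z _|]; last exact: open_neq.
    apply: (@continuous_big _ _ +%R 0) => [|v _]; last by have [] := gE v.
    exact: add_continuous.
  have [|x /eqP[]] := stone_cech_dense oW; first by exists y; apply/eqP.
  have -> : \sum_v g v (i x) = \sum_v f v x / S x.
    by apply: eq_bigr => v _; rewrite (gE v).2.
  by rewrite -mulr_suml divff // (gt_eqF (S0 x)).
apply/seteqP; split => // y _.
have [v gvy] : exists v, 0 < g v y.
  apply: contrapT => /forallNP gy; have : \sum_v g v y <= 0.
    by apply: sumr_le0 => v _; rewrite leNgt; apply/negP; exact: gy.
  by rewrite sum1 ler10.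
exists v => //; apply: (@sub_ext [set y | 0 < g v y]) => //.
  rewrite -[mkset _]/(g v @^-1` [set r | 0 < r]).
  by apply: open_comp => [z _|]; [exact: (gE v).1|exact: open_gt].
move=> x /=; rewrite (gE v).2 pmulr_lgt0 ?invr_gt0 // => fvx.
have [_ /(_ x)/andP[_ f1] ->] := fU v; by rewrite /= in_itv /= fvx.
Qed.

(** Each [y] gets a Urysohn function, 0 at [y] and 1 off a member of [W]. Finitely many of the sets
    where these functions are below 1/2 cover, and their traces form [a]; the gap between 1/2 and 1
    keeps the extensions inside the members. *)
Lemma functional_refinement (J : Type) (W : J -> set Y) :
  (forall j, open (W j)) -> \bigcup_j W j = setT ->
  exists a : functional_cover R X, exists p : 'I_(projT1 a) -> J,
    forall v, ext (sval (projT2 a) v) `<=` W (p v).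
Proof.
move=> oW Wcov.
have [[cptY hY _ _] _] := iSC.
have /choice[j jP] : forall y : Y, exists j, W j y.
  move=> y; have [j _ Wj] : (\bigcup_j W j) y by rewrite Wcov.
  by exists j.
have /choice[h hP] (y : Y) : exists h : Y -> R, [/\ continuous h, forall z, 0 <= h z,
    h y = 0 & forall z, ~ W (j y) z -> h z = 1].
  have crY : completely_regular_space Y.
    apply: (@normal_completely_regular R); first exact: compact_normal.
    exact: hausdorff_accessible.
  have /(@uniform_separatorP _ R)[h [ch h01 h0 h1]] :=
    crY y (~` W (j y)) (open_closedC (oW (j y))) (fun n => n (jP y)).
  exists h; split => // [z||z Wz].
  - by have := h01 (h z); rewrite /= in_itv /= => /(_ (imageT _ _))/andP[].
  - by apply: h0; exists y.
  - by apply: h1; exists z.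
have oO y : open (h y @^-1` [set r | r < 2^-1]).
  have [ch _ _ _] := hP y.
  by apply: open_comp => [z _|]; [exact: ch|exact: open_lt].
have [|D DY] := compact_pointwise_cover
  (O := fun y => h y @^-1` [set r | r < 2^-1]) cptY _ oO.
  by move=> y /=; have [_ _ -> _] := hP y; rewrite invr_gt0.
pose t : 'I_(size D) -> Y := tnth (in_tuple D).
pose U v := [set x | h (t v) (i x) < 2^-1].
have oU v : functionally_open R (U v).
  have [ch h0 _ _] := hP (t v).
  (* Truncating [1 - 2 * h] at 0 gives a function positive exactly where [h] is below 1/2, and at
     most 1 because [h] is nonnegative. *)
  exists (fun x => Num.max 0 (1 - 2 * h (t v) (i x))); split.
  - move=> x; apply: (@continuous_max R X (fun=> 0) (fun x => 1 - 2 * h (t v) (i x))).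
      exact: cvg_cst.
    apply: cvgB; first exact: cvg_cst.
    apply: cvgM; first exact: cvg_cst.
    by apply: continuous_comp; [exact: stone_cech_continuous|exact: ch].
  - by move=> x; rewrite le_max lexx /= ge_max ler01 gerBl mulr_ge0.
  - apply/seteqP; split => x; rewrite /U /= in_itv /= lt_max ltxx /= subr_gt0.
      move=> hx; rewrite mulrC -ltr_pdivlMr // mul1r hx /=.
      by rewrite ge_max ler01 gerBl mulr_ge0.
    by move=> /andP[]; rewrite mulrC -ltr_pdivlMr // mul1r.
have Ucov : \bigcup_v U v = setT.
  apply/seteqP; split => // x _; have [y yD hy] := DY (i x).
  have /tnthP[v yv] : y \in in_tuple D by [].
  by exists v => //; rewrite /U /= /t -yv.
exists (existT _ (size D) (exist _ U (conj oU Ucov))), (j \o t) => v z /= Uz.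
have [ch _ _ h1] := hP (t v); apply: contrapT => /h1 hz.
(* If [h] were 1 at a point of the extension, this open set would contain a point of X, where [h] is
   both below and above 1/2. *)
have oV : open (ext (U v) `&` h (t v) @^-1` [set r | 2^-1 < r]).
  apply: openI; first exact: open_ext.
  by apply: open_comp => [x _|]; [exact: ch|exact: open_gt].
have [|x [/ext_trace Ux /= /lt_trans/(_ Ux)]] := stone_cech_dense oV.
  by exists z; split => //=; rewrite hz invf_lt1 // ltr1n.
by rewrite ltxx.
Qed.
End StoneCech.

(** * Comparison of the limit groups *)

Section LimitCohomology.
Variables (X : Type) (C : cover_system X) (n : nat) (G : zmodType).

Definition cover_cohomology (a : cover_of C) : zmodType :=
  cohomology (nerve (@cover_member X C a)) n G.

Definition cover_transition (a b : cover_of C) :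
    set (cover_cohomology a -> cover_cohomology b) :=
  [set phi | exists (p : cover_index b -> cover_index a)
     (hp : refinement_projection (@cover_member X C a) (@cover_member X C b) p),
     phi = cohomology_map (nerve_map hp) (G := G)].

Definition limit_class (a : cover_of C) (x : cover_cohomology a) :
  limit_cohomology C n G := limit_inj cover_transition x.

Lemma limit_classB a (x y : cover_cohomology a) :
  limit_class (x - y) = limit_class x - limit_class y.
Proof. exact: limit_injB. Qed.

Lemma limit_class_refinement (a b : cover_of C)
    (p : cover_index b -> cover_index a)
    (hp : refinement_projection (@cover_member X C a) (@cover_member X C b) p)
    (x : cover_cohomology a) :
  limit_class (cohomology_map (nerve_map hp) x : cover_cohomology b) =
  limit_class x.
Proof. by apply: limit_inj_transition; exists p, hp. Qed.

Lemma trivial_limit_cohomology :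
  (forall a (x : cover_cohomology a), limit_class x = 0) ->
  trivial_group (limit_cohomology C n G).
Proof. exact: trivial_direct_limit. Qed.

(** Vanishing is transported this way: a compatible family factors through the limit, so it is zero
    once the limit is. *)
Lemma trivial_limit_cohomology_desc (H : zmodType)
    (theta : forall a, cover_cohomology a -> H) :
  (forall a (x y : cover_cohomology a), theta a (x - y) = theta a x - theta a y) ->
  (forall (a b : cover_of C) (p : cover_index b -> cover_index a)
    (hp : refinement_projection (@cover_member X C a) (@cover_member X C b) p)
    (x : cover_cohomology a),
    theta b (cohomology_map (nerve_map hp) x) = theta a x) ->
  trivial_group (limit_cohomology C n G) ->
  forall a (x : cover_cohomology a), theta a x = 0.
Proof.
move=> thetaB theta_ref triv a x.
apply: (@limit_inj_eq0 _ _ cover_transition _ theta) => //.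
by move=> b c _ y [p [hp ->]]; exact: theta_ref.
Qed.

End LimitCohomology.

(** * Simplicial maps between nerves over X and over its compactification *)

Section TraceMaps.
Variables (R : realType) (X Y : topologicalType) (i : X -> Y).
Hypothesis iSC : stone_cech i.
Variables (V J : Type) (U : V -> set X) (W : J -> set Y).

Lemma trace_face (p : V -> J) :
  (forall v x, U v x -> W (p v) (i x)) ->
  forall s, face (nerve U) s -> face (nerve W) (p @` s).
Proof.
move=> hp s [[v sv] fs [x Ux]]; split; first by exists (p v), v.
  exact: finite_image.
by exists (i x) => _ [v' sv' <-]; apply: hp; exact: Ux.
Qed.

Definition trace_map (p : V -> J) (hp : forall v x, U v x -> W (p v) (i x)) :
  simplicial_map (nerve U) (nerve W) := SimplicialMap (trace_face hp).

Hypothesis oW : forall j, open (W j).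

(** A finite intersection of open sets is open, so if nonempty it contains a point of the dense
    image of X. *)
Lemma dense_face (q : J -> V) :
  (forall j x, W j (i x) -> U (q j) x) ->
  forall s, face (nerve W) s -> face (nerve U) (q @` s).
Proof.
move=> hq s [[j sj] fs W0]; split; first by exists (q j), j.
  exact: finite_image.
have oWs : open (\bigcap_(j in s) W j).
  rewrite -[X in open X]setCK; apply: closed_openC; rewrite setC_bigcap.
  apply: (@closed_bigcup _ {classic J} s (fun j => ~` W j)) => // j' _.
  exact: open_closedC.
have [x Wx] := stone_cech_dense iSC oWs W0.
by exists x => _ [j' sj' <-]; apply: hq; exact: Wx.
Qed.

Definition dense_map (q : J -> V) (hq : forall j x, W j (i x) -> U (q j) x) :
  simplicial_map (nerve W) (nerve U) := SimplicialMap (dense_face hq).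

End TraceMaps.

(** * Compatible families in both directions *)

Section Comparison.
Variables (R : realType) (X Y : topologicalType) (i : X -> Y).
Hypothesis iSC : stone_cech i.
Variables (n : nat) (G : zmodType).

Let CF : cover_system X := functional_covers R X.
Let CO : cover_system Y := open_covers Y.
Let AF (a : cover_of CF) := cover_cohomology n G a.
Let AO (b : cover_of CO) := cover_cohomology n G b.
Let U (a : cover_of CF) := @cover_member X CF a.
Let W (b : cover_of CO) := @cover_member Y CO b.

Let openU a v : open (@U a v).
Proof. by apply: (@functionally_open_open R); exact: (svalP (projT2 a)).1. Qed.

Let openW b j : open (@W b j).
Proof. exact: (svalP b).1 (svalP j). Qed.

Let coverW b : \bigcup_j @W b j = setT.
Proof.
apply/seteqP; split=> // y _.
have [S bS Sy] : (\bigcup_(S in sval b) S) y by rewrite (svalP b).2.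
by exists (exist _ S bS).
Qed.

Fact ext_cover_proof (a : cover_of CF) :
  (forall S, range (fun v => ext i (@U a v)) S -> open S) /\
  \bigcup_(S in range (fun v => ext i (@U a v))) S = setT.
Proof.
split => [_ [v _ <-]|]; first exact: open_ext.
rewrite bigcup_image; apply: (ext_functional_cover iSC (R := R)).
  exact: (svalP (projT2 a)).1.
exact: (svalP (projT2 a)).2.
Qed.

Definition ext_cover (a : cover_of CF) : cover_of CO :=
  exist _ (range (fun v => ext i (@U a v))) (ext_cover_proof a).

Definition ext_index a (v : cover_index a) : cover_index (ext_cover a) :=
  exist _ (ext i (@U a v)) (ex_intro2 _ _ v I erefl).

Lemma ext_section_proof a (S : cover_index (ext_cover a)) :
  exists v, ext i (@U a v) = W S.
Proof. by have [v _ vS] := svalP S; exists v. Qed.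

(** Indices with equal extensions are merged in [ext_cover], so coming back is a choice, and
    [ext_section (ext_index v)] need not be [v]. *)
Definition ext_section a (S : cover_index (ext_cover a)) : cover_index a :=
  sval (cid (ext_section_proof S)).

Lemma ext_sectionE a (S : cover_index (ext_cover a)) :
  ext i (@U a (ext_section S)) = W S.
Proof. exact: svalP (cid (ext_section_proof S)). Qed.

Lemma ext_section_trace a (S : cover_index (ext_cover a)) x :
  W S (i x) -> @U a (ext_section S) x.
Proof. by rewrite -ext_sectionE; exact: ext_trace. Qed.

Definition section_map a : simplicial_map (nerve (@W (ext_cover a))) (nerve (@U a)) :=
  dense_map iSC (@openW (ext_cover a)) (@ext_section_trace a).

Lemma ext_index_trace a v x : @U a v x -> W (ext_index v) (i x).
Proof. exact: (trace_ext iSC (openU v)). Qed.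

(** This makes the round trip through the extension a refinement projection of the cover to itself,
    which acts trivially on limit classes. *)
Lemma section_index_sub a v : @U a v `<=` @U a (ext_section (ext_index v)).
Proof. by move=> x /ext_index_trace; exact: ext_section_trace. Qed.

Definition to_cech a (x : AF a) : cech_cohomology Y n G :=
  limit_class (cohomology_map (section_map a) x : AO (ext_cover a)).

Lemma to_cechB a (x y : AF a) : to_cech (x - y) = to_cech x - to_cech y.
Proof. by rewrite /to_cech cohomology_mapB limit_classB. Qed.

(* The indexed cover [a] and its extension, which is a set of open sets, have
   nerves that differ by repeated members: this is where the invariance of
   induced maps under contiguity is needed. *)
Lemma to_cech_refinement (a b : cover_of CF) (p : cover_index b -> cover_index a)
    (hp : refinement_projection (@U a) (@U b) p) (x : AF a) :
  to_cech (cohomology_map (nerve_map hp) x : AF b) = to_cech x.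
Proof.
(* Composing [p] with the round trip makes the square with [r] commute strictly on vertices. *)
pose q (v : cover_index b) : cover_index a := ext_section (ext_index (p v)).
have hq : refinement_projection (@U a) (@U b) q.
  by move=> v y /hp; exact: section_index_sub.
rewrite (cohomology_map_refinement hp hq).
pose r (S : cover_index (ext_cover b)) : cover_index (ext_cover a) :=
  ext_index (p (ext_section S)).
have hr : refinement_projection (@W (ext_cover a)) (@W (ext_cover b)) r.
  move=> S; rewrite -ext_sectionE; apply: ext_subset; exact: hp.
rewrite /to_cech -[RHS](limit_class_refinement hr); congr limit_class.
have hm S y : W S (i y) -> @U a (q (ext_section S)) y.
  by move=> /ext_section_trace; exact: hq.
rewrite (cohomology_map_comp (h := dense_map iSC (@openW _) hm)) //.
by rewrite (cohomology_map_comp (h := dense_map iSC (@openW _) hm)).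
Qed.

(** Pulling back to the nerve of [a] and then to that of its extension is the map of a refinement
    projection, so the class in the limit is unchanged. *)
Lemma to_cech_onto (b : cover_of CO) (x : AO b) :
  exists a (y : AF a), limit_class x = to_cech y.
Proof.
have [a [p hp]] := functional_refinement R iSC (@openW b) (coverW b).
have hp' v y : @U a v y -> W (p v) (i y).
  by move=> /(trace_ext iSC (openU v)); exact: hp.
exists a, (cohomology_map (trace_map hp') x).
have hq : refinement_projection (@W b) (@W (ext_cover a)) (p \o ext_section (a := a)).
  by move=> S; rewrite -ext_sectionE; exact: hp.
rewrite -(limit_class_refinement hq) /to_cech; congr limit_class.
by rewrite (cohomology_map_comp (h := nerve_map hq)).
Qed.

Lemma trivial_functional_cech :
  trivial_group (functional_cohomology R X n G) ->
  trivial_group (cech_cohomology Y n G).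
Proof.
move=> triv; apply: trivial_limit_cohomology => b x.
have [a [y ->]] := to_cech_onto x.
exact: (trivial_limit_cohomology_desc to_cechB to_cech_refinement triv).
Qed.

Fact sum_cover_proof (a b : cover_of CF) :
  let S (v : 'I_(projT1 a + projT1 b)) :=
    match fintype.split v with inl j => @U a j | inr j => @U b j end in
  (forall v, functionally_open R (S v)) /\ \bigcup_v S v = setT.
Proof.
split => [v|].
  case: fintype.split => j; first exact: (svalP (projT2 a)).1.
  exact: (svalP (projT2 b)).1.
apply/seteqP; split => // x _.
have [v _ Uv] : (\bigcup_v @U a v) x by rewrite (svalP (projT2 a)).2.
by exists (lshift _ v) => //; rewrite (unsplitK (inl v)).
Qed.

Definition sum_cover (a b : cover_of CF) : cover_of CF :=
  existT _ (projT1 a + projT1 b)%N (exist _ _ (sum_cover_proof a b)).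

(* [p] and [p'] are both restrictions of a map defined on the disjoint union of
   [a] and [a'], which is again a functional cover refining the trace of [b]:
   hence the independence of the choices needs no contiguity argument. *)
Lemma limit_class_trace (b : cover_of CO) (a a' : cover_of CF)
    (p : cover_index a -> cover_index b) (p' : cover_index a' -> cover_index b)
    (hp : forall v x, @U a v x -> W (p v) (i x))
    (hp' : forall v x, @U a' v x -> W (p' v) (i x)) (x : AO b) :
  limit_class (cohomology_map (trace_map hp) x : AF a) =
  limit_class (cohomology_map (trace_map hp') x : AF a').
Proof.
pose q (v : cover_index (sum_cover a a')) : cover_index b :=
  match fintype.split v with inl j => p j | inr j => p' j end.
have hq v y : @U (sum_cover a a') v y -> W (q v) (i y).
  by rewrite /U /q /=; case: fintype.split => j; [exact: hp|exact: hp'].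
have hl : refinement_projection (@U (sum_cover a a')) (@U a) (lshift (projT1 a')).
  by move=> v y Uy; rewrite /U /= (unsplitK (inl v)).
have hr : refinement_projection (@U (sum_cover a a')) (@U a') (@rshift (projT1 a) _).
  by move=> v y Uy; rewrite /U /= (unsplitK (inr v)).
transitivity (limit_class (cohomology_map (trace_map hq) x : AF (sum_cover a a'))).
  rewrite -(limit_class_refinement hl); congr limit_class.
  rewrite (cohomology_map_comp (h := trace_map hp)) // => v /=.
  by rewrite /q (unsplitK (inl v)).
rewrite -(limit_class_refinement hr); congr limit_class.
rewrite (cohomology_map_comp (h := trace_map hp')) // => v /=.
by rewrite /q (unsplitK (inr v)).
Qed.

(** The choice is made as data because [to_functional] is defined from it. *)
Lemma trace_refinement (b : cover_of CO) :
  {a : cover_of CF & {p : cover_index a -> cover_index b |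
    forall v x, @U a v x -> W (p v) (i x)}}.
Proof.
have /cid[a /cid[p hp]] := functional_refinement R iSC (@openW b) (coverW b).
by exists a, p => v x /(trace_ext iSC (openU v)); exact: hp.
Qed.

Definition to_functional b (x : AO b) : functional_cohomology R X n G :=
  limit_class (cohomology_map (trace_map (svalP (projT2 (trace_refinement b)))) x
    : AF (projT1 (trace_refinement b))).

Lemma to_functionalB b (x y : AO b) :
  to_functional (x - y) = to_functional x - to_functional y.
Proof. by rewrite /to_functional cohomology_mapB limit_classB. Qed.

Lemma to_functional_refinement (b c : cover_of CO)
    (p : cover_index c -> cover_index b)
    (hp : refinement_projection (@W b) (@W c) p) (x : AO b) :
  to_functional (cohomology_map (nerve_map hp) x : AO c) = to_functional x.
Proof.
rewrite /to_functional; case: (trace_refinement c) => a [q hq] /=.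
(* The cover chosen for [c] also refines the trace of [b], through [p], and the class does not
   depend on which such cover is taken. *)
have hpq v y : @U a v y -> W (p (q v)) (i y) by move=> /hq/hp.
rewrite (cohomology_map_comp (h := trace_map hpq)) //.
exact: limit_class_trace.
Qed.

Lemma to_functional_onto (a : cover_of CF) (x : AF a) :
  exists b (y : AO b), limit_class x = to_functional y.
Proof.
exists (ext_cover a), (cohomology_map (section_map a) x).
(* The cover chosen for [ext_cover a] is exchanged for [a] itself; the composite is then the round
   trip on [a]. *)
rewrite /to_functional (limit_class_trace _ (@ext_index_trace a)).
rewrite (cohomology_map_comp (h := nerve_map (@section_index_sub a))) //.
by rewrite limit_class_refinement.
Qed.

Lemma trivial_cech_functional :
  trivial_group (cech_cohomology Y n G) ->
  trivial_group (functional_cohomology R X n G).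
Proof.
move=> triv; apply: trivial_limit_cohomology => a x.
have [b [y ->]] := to_functional_onto x.
exact: (trivial_limit_cohomology_desc to_functionalB to_functional_refinement triv).
Qed.

End Comparison.

Lemma cyclicity_equiv (X Y : Type) (H K : nat -> zmodType) e :
  (inhabited X <-> inhabited Y) ->
  (forall m, trivial_group (H m) <-> trivial_group (K m)) ->
  cyclicity X H e -> cyclicity Y K e.
Proof.
move=> XY HK; case=> [X0|n H0 Hn|X1 Hn].
- by apply: cyclicity_empty => y; have [x] := XY.2 (inhabits y); exact: X0.
- apply: cyclicity_fin => [m nm|]; first exact/HK/H0.
  by move=> /HK.
- apply: cyclicity_infty; first exact: XY.1.
  by move=> m; have [n mn Hn'] := Hn m; exists n => // /HK.
Qed.

Theorem corollary2p5 (R : realType) (X betaX : topologicalType)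
    (i : X -> betaX) (G : zmodType) (n : int)
    (hX : tychonoff_space X) (hbeta : stone_cech i) (hn : -1 <= n) :
  cech_cyclicity G betaX n%:E <-> functional_cyclicity R G X n%:E.
Proof.
(* The value -1 is tied to emptiness. A point of [betaX] yields one of [X], since the whole space is
   open and the image of [X] is dense. *)
have XY : inhabited X <-> inhabited betaX.
  split=> -[x]; first by exists; exact: i x.
  have [|x' _] := stone_cech_dense hbeta openT; first by exists x.
  by exists.
have triv m : trivial_group (cech_cohomology betaX m G) <->
    trivial_group (functional_cohomology R X m G).
  split; first exact: (@trivial_cech_functional R X betaX i hbeta).
  exact: (@trivial_functional_cech R X betaX i hbeta).
split; apply: cyclicity_equiv => //; first exact: iff_sym.
by move=> m; exact: iff_sym.
Qed.
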